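(* Let $0<s<1$, $2<p<\infty$ and $0<\lambda<1$ be such that $1/p<s<\lambda<1-1/p$. Define $f:\mathbb R\to\mathbb R$ by $f(x)=x^\lambda$ for $x\ge1$ and $f(x)=1$ for $x<1$. Then $$f\in\tilde W^{s-1/p,p}_{\le1}(\mathbb R)\setminus\tilde W^{s+1/p,p}_{\ge1}(\mathbb R).$$
   Context: For $g\in L^p_{\rm loc}(\mathbb R)$ and $\sigma>0$: $g\in\tilde W^{\sigma,p}_{\le1}(\mathbb R)$ iff $\int_{\mathbb R}\int_{|x-y|<1}\frac{|g(x)-g(y)|^p}{|x-y|^{1+\sigma p}}\,dy\,dx<\infty$; $g\in\tilde W^{\sigma,p}_{\ge1}(\mathbb R)$ iff $\int_{\mathbb R}\int_{|x-y|\ge1}\frac{|g(x)-g(y)|^p}{|x-y|^{1+\sigma p}}\,dy\,dx<\infty$. *)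

(* Defs.v *)
From HB Require Import structures.
From mathcomp Require Import all_boot all_order all_algebra.
From mathcomp Require Import all_classical all_reals all_analysis.

Set Implicit Arguments.
Unset Strict Implicit.
Unset Printing Implicit Defensive.

Import Order.TTheory GRing.Theory Num.Theory.
Import numFieldNormedType.Exports.

Local Open Scope classical_set_scope.
Local Open Scope ring_scope.

(* [locally_integrable] alone would only give measurability of |g|^p, hence
   the separate measurability of g itself. *)
Definition Lp_loc (R : realType) (p : R) : set (R -> R) :=
  [set g : R -> R | measurable_fun setT g /\
           locally_integrable setT (fun x : R => `|g x| `^ p)].

(* On the diagonal x = y the quotient takes the value 0 because 0^-1 = 0; for
   each x this concerns a single y, which is Lebesgue-null. *)
Definition gagliardo (R : realType) (sigma p : R) (g : R -> R) (x y : R) : R :=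
  `|g x - g y| `^ p / `|x - y| `^ (1 + sigma * p).

Definition Wtilde_le1 (R : realType) (sigma p : R) : set (R -> R) :=
  [set g : R -> R | Lp_loc p g /\
    (\int[@lebesgue_measure R]_(x in setT)
       \int[@lebesgue_measure R]_(y in [set y : R | (`|x - y| < 1)%R])
         (gagliardo sigma p g x y)%:E < +oo)%E].

Definition Wtilde_ge1 (R : realType) (sigma p : R) : set (R -> R) :=
  [set g : R -> R | Lp_loc p g /\
    (\int[@lebesgue_measure R]_(x in setT)
       \int[@lebesgue_measure R]_(y in [set y : R | (1 <= `|x - y|)%R])
         (gagliardo sigma p g x y)%:E < +oo)%E].

Definition power_tail (R : realType) (lambda x : R) : R :=
  if 1 <= x then x `^ lambda else 1.

(* Main.v *)
(** Write f for the power tail and X = max(1, x). Near the diagonal f is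
    Lipschitz with constant of order X^(lambda-1), and f is constant on the left
    half-line; as sp < p the quotient is therefore at most a constant times
    X^(-(1-lambda)p) for x >= 0, and (1-lambda)p > 1 makes this integrable. Far
    from the diagonal, on the square x in [N, 2N], y in [-N, 0] of area N^2 the
    quotient is at least a constant times N^(lambda p) / N^(sp+2), so the
    integral is at least c N^((lambda-s)p) for all large N. *)

Require Import Defs.
From mathcomp Require Import all_boot all_order all_algebra.
From mathcomp Require Import all_classical all_reals all_analysis.
From mathcomp Require Import measurable_realfun lra.

Import Order.TTheory GRing.Theory Num.Theory.
Import numFieldNormedType.Exports.

Local Open Scope classical_set_scope.
Local Open Scope ring_scope.

(* Unlike [ge0_le_integral], this needs no measurability, so it applies to
   partial integrals x |-> \int f(x, y) dy as they stand. *)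
Lemma le_integral_restrict d (T : measurableType d) (R : realType)
    (mu : {measure set T -> \bar R}) (D E : set T) (f g : T -> \bar R) :
  (forall x, 0 <= (f \_ D) x)%E -> (forall x, (f \_ D) x <= (g \_ E) x)%E ->
  (\int[mu]_(x in D) f x <= \int[mu]_(x in E) g x)%E.
Proof.
move=> f0 fg; rewrite integral_mkcond [leRHS]integral_mkcond.
rewrite !ge0_integralTE//; last by move=> x; exact: le_trans (fg x).
(* Both sides are suprema over nonnegative simple functions below the integrand, and a larger
   integrand admits more of them. *)
apply: le_ereal_sup => /= _ [h hf <-]; exists h => // x.
exact: le_trans (hf x) (fg x).
Qed.

(** * Estimates for real powers *)

Lemma le_powR_neg {R : realType} (a b r : R) :
  0 < a -> a <= b -> r <= 0 -> b `^ r <= a `^ r.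
Proof.
move=> a0 ab r0; have b0 : 0 < b by exact: lt_le_trans ab.
rewrite -(opprK r) !(powRN _ (- r)) lef_pV2 ?posrE ?powR_gt0//.
by rewrite ge0_ler_powR ?oppr_ge0 ?nnegrE ?(ltW a0) ?(ltW b0).
Qed.

(** Dividing by y^l reduces this to t^l - 1 <= t - 1 for t = x / y >= 1, that is, to t^l <= t. *)
Lemma powRB_le {R : realType} (l x y : R) : l <= 1 -> 0 < y -> y <= x ->
  x `^ l - y `^ l <= y `^ (l - 1) * (x - y).
Proof.
move=> l1 y0 yx; have yl z : y `^ (l - 1) * (y * z) = y `^ l * z.
  rewrite powRB ?(gt_eqF y0) ?implybT// powRr1 ?ltW// mulrA mulfVK//.
  by rewrite gt_eqF.
have y1 : 1 <= x / y by rewrite ler_pdivlMr ?mul1r.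
have -> : x - y = y * (x / y - 1).
  by rewrite mulrBr mulr1 mulrCA divff ?mulr1// gt_eqF.
rewrite yl mulrBr mulr1 lerB//.
rewrite -[X in X `^ l](mulfVK (lt0r_neq0 y0)) mulrC powRM//; last 2 first.
- exact: ltW.
- exact: le_trans y1.
by rewrite ler_wpM2l ?powR_ge0 ?ler1_powR.
Qed.

(** With b = a - 1 > 0, the antiderivative -(1 + x)^(-b) / b vanishes at infinity. *)
Lemma integral_powR_shift_lty {R : realType} (a : R) : 1 < a ->
  (\int[@lebesgue_measure R]_(x in `[0%R, +oo[)
     ((1 + x) `^ (- a))%:E < +oo)%E.
Proof.
move=> a1; pose b := a - 1; have b0 : 0 < b by rewrite subr_gt0.
have dF (x r : R) : 0 <= x ->
    is_derive x 1 (fun x : R => (1 + x) `^ r) (r * (1 + x) `^ (r - 1)).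
  move=> x0; have x1 : 0 < 1 + x by lra.
  have h : is_derive x 1 (fun x : R => 1 + x) 1.
    by rewrite -[X in is_derive _ _ _ X]add0r; apply: is_deriveD.
  have := @is_derive1_comp _ (fun z : R => z `^ r) (fun x => 1 + x) x _ _
    (is_derive1_powR r x1) h.
  by rewrite mulr1.
have cF (x r : R) : 0 <= x -> {for x, continuous (fun x : R => (1 + x) `^ r)}.
  by move=> x0; apply/differentiable_continuous/derivable1_diffP;
     have [] := dF x r x0.
have dG (x : R) : 0 <= x ->
    is_derive x 1 (fun x : R => - b^-1 * (1 + x) `^ (- b)) ((1 + x) `^ (- a)).
  move=> x0.
  have -> : (1 + x) `^ (- a) = - b^-1 * (- b * (1 + x) `^ (- b - 1)).
    by rewrite mulrA mulrNN mulVf ?gt_eqF// mul1r /b; congr (_ `^ _); lra.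
  by have := dF x (- b) x0 => ?; apply: is_deriveZ.
(* The two zeros are the left endpoint and the limit of the antiderivative at infinity. *)
rewrite (@ge0_continuous_FTC2y _ _ (fun x : R => - b^-1 * (1 + x) `^ (- b)) 0 0).
- by rewrite -EFinB ltry.
- by move=> x _; rewrite powR_ge0.
- apply/continuous_within_itvcyP; split.
    by move=> x; rewrite in_itv/= andbT => /ltW x0; exact: cF.
  by apply: cvg_at_right_filter; exact: cF.
- rewrite -[X in _ --> X](mulr0 (- b^-1)); apply: cvgM; first exact: cvg_cst.
  under eq_fun do rewrite powRN.
  apply/gtr0_cvgV0.
    by near=> x; rewrite powR_gt0// ltr_pwDl//; near: x; exact: nbhs_pinfty_ge.
  apply/cvgryPge => A.
  near=> x; have x0 : 0 <= x by near: x; exact: nbhs_pinfty_ge.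
  (* Past this threshold (1 + x)^b >= |A|. *)
  have : (`|A| `^ b^-1) <= x by near: x; apply: nbhs_pinfty_ge; exact: num_real.
  move=> Ax; apply: (le_trans (ler_norm _)).
  have -> : `|A| = (`|A| `^ b^-1) `^ b.
    by rewrite -powRrM mulVf ?gt_eqF// powRr1.
  apply: ge0_ler_powR; rewrite ?nnegrE ?powR_ge0 ?(ltW b0)//.
    by rewrite addr_ge0.
  by rewrite (le_trans Ax)// lerDr.
- by move=> x /ltW x0; have [] := dG x x0.
- apply: cvg_at_right_filter; apply: cvgM; first exact: cvg_cst.
  exact: cF.
- move=> x; rewrite in_itv/= andbT => /ltW x0.
  by rewrite derive1E; have [_ ->] := dG x x0.
Unshelve. all: by end_near.
Qed.

(** * The power tail and its local integrability *)

Lemma power_tailE {R : realType} (l x : R) :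
  power_tail l x = (Num.max 1 x) `^ l.
Proof. by rewrite /power_tail; case: leP => //; rewrite powR1. Qed.

Lemma Lp_loc_power_tail {R : realType} (p l : R) : 0 <= p -> 0 <= l ->
  Lp_loc p (power_tail l).
Proof.
move=> p0 l0.
have mf : measurable_fun setT (power_tail l : R -> R).
  rewrite (_ : power_tail l = (@powR R ^~ l) \o (cst 1 \max id)); last first.
    by apply/funext => x /=; rewrite power_tailE.
  by apply: measurableT_comp; [exact: measurable_powR|exact: measurable_maxr].
split => //; split; [|exact: openT|move=> K _ cK].
  apply: (@measurableT_comp _ _ _ _ _ _ (@powR R ^~ p)).
    exact: measurable_powR.
  exact: measurableT_comp.
have mK := compact_measurable cK.
have [N [_ NK]] := compact_bounded cK.
(* Boundedness of K gives |x| <= r only for r strictly above N, hence N + 1; the maximum with 1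
   covers the constant branch. *)
pose M := Num.max 1 (N + 1).
have fM x : K x -> `|power_tail l x| `^ p <= (M `^ l) `^ p.
  move=> Kx.
  rewrite power_tailE.
  rewrite ger0_norm; last exact: powR_ge0.
  apply: ge0_ler_powR; rewrite ?nnegrE ?powR_ge0//.
  apply: ge0_ler_powR; rewrite // ?nnegrE; [by rewrite le_max ler01..|].
  rewrite ge_max /M !le_max lexx/=; apply/orP; right.
  by rewrite (le_trans (ler_norm x))// NK// ltrDl.
apply: (@le_lt_trans _ _
    (\int[lebesgue_measure]_(x in K) cst ((M `^ l) `^ p)%:E x)%E).
  apply: le_integral_restrict => x; rewrite !patchE; case: ifPn => // xK.
  by rewrite lee_fin ger0_norm ?powR_ge0// fM//; exact: set_mem.
by rewrite integral_cst// lte_mul_pinfty ?lee_fin ?powR_ge0 ?compact_finite_measure.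
Qed.

(** * Near the diagonal *)

(** Both max(1, x) and max(1, y) are at least (1 + x) / 4, so [powRB_le] at the smaller of them,
    with l - 1 <= 0, gives this constant. *)
Lemma power_tailB_le {R : realType} (l x y : R) : 0 <= l <= 1 -> 0 <= x ->
  `|x - y| < 1 ->
  `|power_tail l x - power_tail l y| <= ((1 + x) / 4) `^ (l - 1) * `|x - y|.
Proof.
move=> /andP[l0 l1] x0 xy; rewrite !power_tailE.
have x4 : 0 < (1 + x) / 4 by lra.
have key (u v : R) : (1 + x) / 4 <= v -> v <= u -> `|u - v| <= `|x - y| ->
    `|u `^ l - v `^ l| <= ((1 + x) / 4) `^ (l - 1) * `|x - y|.
  move=> v4 vu uv; have v0 : 0 < v by exact: lt_le_trans v4.
  rewrite ger0_norm ?subr_ge0; last first.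
    by apply: ge0_ler_powR; rewrite ?nnegrE ?(ltW v0)// (le_trans (ltW v0)).
  apply: (le_trans (powRB_le _ _ _ l1 v0 vu)).
  rewrite ler_pM ?powR_ge0 ?subr_ge0//.
    by rewrite le_powR_neg// subr_le0.
  by rewrite (le_trans _ uv)// ler_norm.
have mx : (1 + x) / 4 <= Num.max 1 x.
  by rewrite le_max; apply/orP; case: (leP x 1) => ?; [left|right]; lra.
have my : (1 + x) / 4 <= Num.max 1 y.
  rewrite le_max; apply/orP; case: (leP x 2) => ?; [left|right]; first lra.
  by move: xy; rewrite ltr_norml => /andP[]; lra.
have m1 : `|Num.max 1 x - Num.max 1 y| <= `|x - y|.
  case: (leP 1 x) => ?; case: (leP 1 y) => ?; rewrite ?subrr ?normr0//;
    rewrite ler_norml; have := ler_norm (x - y);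
    have := ler_norm (- (x - y)); rewrite normrN => *; lra.
have [xy'|/ltW xy'] := leP (Num.max 1 x) (Num.max 1 y).
  by rewrite distrC; apply: key; rewrite // distrC.
exact: key.
Qed.

(** The denominator is |x - y|^(sp), and the Lipschitz bound leaves |x - y|^p in the numerator; as
    |x - y| < 1 and sp <= p, their ratio is at most 1. *)
Lemma gagliardo_near_le {R : realType} (s p l x y : R) :
  0 < s < 1 -> 0 < p -> 0 <= l <= 1 -> 0 <= x -> `|x - y| < 1 ->
  gagliardo (s - 1 / p) p (power_tail l) x y <=
  ((1 + x) / 4) `^ (- ((1 - l) * p)).
Proof.
move=> /andP[s0 s1] p0 l01 x0 xy; rewrite /gagliardo.
have -> : 1 + (s - 1 / p) * p = s * p.
  by rewrite mulrBl mul1r mulVf ?gt_eqF// addrCA subrr addr0.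
have [->|xNy] := eqVneq x y.
  by rewrite subrr normr0 powR0 ?gt_eqF// mul0r powR_ge0.
have xy0 : 0 < `|x - y| by rewrite normr_gt0 subr_eq0.
have -> : - ((1 - l) * p) = (l - 1) * p by lra.
rewrite ler_pdivrMr ?powR_gt0// powRrM.
apply: (@le_trans _ _ ((((1 + x) / 4) `^ (l - 1) * `|x - y|) `^ p)).
  apply: ge0_ler_powR; rewrite ?nnegrE ?(ltW p0) ?mulr_ge0 ?powR_ge0//.
  exact: power_tailB_le.
rewrite powRM ?powR_ge0// ler_wpM2l ?powR_ge0// ger_powR ?xy0 ?(ltW xy)//.
by rewrite ger_pMl ?ltW.
Qed.

Lemma gagliardo_near_eq0 {R : realType} (s p l x y : R) :
  0 < p -> x < 0 -> `|x - y| < 1 -> gagliardo s p (power_tail l) x y = 0.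
Proof.
move=> p0 x0; rewrite ltr_norml => /andP[xy _].
rewrite /gagliardo /power_tail !ifF; try by apply/negbTE; rewrite -ltNge; lra.
by rewrite subrr normr0 powR0 ?gt_eqF// mul0r.
Qed.

Lemma Wtilde_le1_power_tail {R : realType} (s p l : R) :
  0 < s < 1 -> 0 < p -> 0 <= l <= 1 -> 1 < (1 - l) * p ->
  Wtilde_le1 (s - 1 / p) p (power_tail l).
Proof.
move=> s01 p0 l01 lp; split.
  by apply: Lp_loc_power_tail; [exact: ltW|case/andP: l01].
set a := (1 - l) * p in lp *.
have g0 (x y : R) : 0 <= gagliardo (s - 1 / p) p (power_tail l) x y.
  by rewrite divr_ge0 ?powR_ge0.
have ballE (x : R) : [set y : R | `|x - y| < 1] = ball x 1 by [].
(* The factor 2 is the length of the interval |x - y| < 1; 4^a comes out of ((1 + x) / 4)^(-a). *)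
apply: (@le_lt_trans _ _ (\int[lebesgue_measure]_(x in `[0%R, +oo[)
    ((2 * 4 `^ a)%:E * ((1 + x) `^ (- a))%:E))%E); last first.
  rewrite ge0_integralZl_EFin//.
  - rewrite lte_mul_pinfty ?lee_fin ?mulr_ge0 ?powR_ge0//.
    exact: integral_powR_shift_lty.
  - by move=> x _; rewrite lee_fin powR_ge0.
  - apply/measurable_EFinP.
    apply: (@measurable_funTS _ _ _ _ _ ((@powR R ^~ (- a)) \o +%R 1)).
    by apply: measurableT_comp; [exact: measurable_powR|exact: measurable_funD].
apply: le_integral_restrict => x; rewrite patch_setT.
  by apply: integral_ge0 => y _; rewrite lee_fin.
rewrite patchE mem_setE in_itv/= andbT; case: (leP 0 x) => x0; last first.
  rewrite integral0_eq// => y xy; rewrite gagliardo_near_eq0//.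
rewrite ballE.
apply: (@le_trans _ _ (\int[lebesgue_measure]_(y in ball x 1)
    cst (((1 + x) / 4) `^ (- a))%:E y)%E).
  apply: le_integral_restrict => y; rewrite !patchE; case: ifPn => // /set_mem xy.
    by rewrite lee_fin.
  by rewrite lee_fin gagliardo_near_le.
rewrite integral_cst; last exact: measurable_ball.
rewrite [X in (_ * X <= _)%E](lebesgue_measure_ball x ler01).
rewrite -!EFinM lee_fin.
have -> : ((1 + x) / 4) `^ (- a) = 4 `^ a * (1 + x) `^ (- a).
  by rewrite powRM ?invr_ge0 ?addr_ge0// -(powR_inv1 (ler0n _ 4)) -powRrM
    mulN1r opprK mulrC.
by rewrite mulr2n; lra.
Qed.

(** * Far from the diagonal *)

(** Restrict to the square [N, 2N] x [-N, 0] one variable at a time: each inner integral with x in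
    [N, 2N] is at least cN. *)
Lemma integral_square_ge {R : realType} (f : R -> R -> R) (A : R -> set R)
    (N c : R) : 0 <= N -> 0 <= c -> (forall x y, 0 <= f x y) ->
  (forall x y, N <= x <= N *+ 2 -> - N <= y <= 0 -> A x y /\ c <= f x y) ->
  ((c * N ^+ 2)%:E <= \int[@lebesgue_measure R]_(x in setT)
     \int[@lebesgue_measure R]_(y in A x) (f x y)%:E)%E.
Proof.
move=> N0 c0 f0 fc.
have mu_itv (u v : R) : u <= v ->
    @lebesgue_measure R `[u, v]%classic = (v - u)%:E.
  rewrite lebesgue_measure_itv /= lte_fin le_eqVlt => /predU1P[->|->].
    by rewrite ltxx subrr.
  by rewrite EFinB.
apply: (@le_trans _ _ (\int[lebesgue_measure]_(x in `[N, (N *+ 2)%R])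
    cst (c * N)%R%:E x)%E).
  rewrite integral_cst//= mu_itv ?mulr2n ?lerDl// -EFinM lee_fin.
  by rewrite addrK expr2 mulrA.
apply: le_integral_restrict => x.
  by rewrite patchE; case: ifPn => // _; rewrite lee_fin mulr_ge0.
rewrite patch_setT patchE mem_setE in_itv/=; case: ifPn => [xN|_]; last first.
  by apply: integral_ge0 => y _; rewrite lee_fin.
apply: (@le_trans _ _ (\int[lebesgue_measure]_(y in `[(- N)%R, 0%R])
    cst c%:E y)%E).
  by rewrite integral_cst//= mu_itv ?oppr_le0// sub0r opprK -EFinM.
apply: le_integral_restrict => y; rewrite !patchE mem_setE in_itv/=.
  by case: ifPn => // _; rewrite lee_fin.
case: ifPn => [yN|_].
  by have [Axy cf] := fc x y xN yN; rewrite mem_set// lee_fin.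
by case: ifPn => // _; rewrite lee_fin.
Qed.

(** Here f(y) = 1, and N^l >= 2 gives f(x) - 1 >= N^l / 2; the denominator is at most (3N)^(sp + 2),
    since |x - y| <= 3N. *)
Lemma gagliardo_far_ge {R : realType} (s p l N x y : R) :
  0 < s -> 0 < p -> 0 < l -> 1 <= N -> 2 <= N `^ l ->
  N <= x <= N *+ 2 -> - N <= y <= 0 ->
  2^-1 `^ p * 3 `^ (- (s * p + 2)) * N `^ ((l - s) * p - 2) <=
  gagliardo (s + 1 / p) p (power_tail l) x y.
Proof.
rewrite mulr2n => s0 p0 l0 N1 Nl /andP[Nx xN] /andP[Ny yN].
have N0 : 0 < N by exact: lt_le_trans N1.
rewrite /gagliardo.
have -> : 1 + (s + 1 / p) * p = s * p + 2.
  by rewrite mulrDl mul1r mulVf ?gt_eqF// addrCA.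
have sp0 : 0 <= s * p + 2 by rewrite addr_ge0// mulr_ge0 ?ltW.
have -> : power_tail l y = 1.
  by rewrite /power_tail ifF//; apply/negbTE; rewrite -ltNge; lra.
have fx : N `^ l <= power_tail l x.
  rewrite /power_tail ifT; last exact: le_trans Nx.
  by apply: ge0_ler_powR; rewrite ?nnegrE; lra.
have num : 2^-1 `^ p * N `^ (l * p) <= `|power_tail l x - 1| `^ p.
  rewrite powRrM -powRM ?powR_ge0//.
  apply: ge0_ler_powR; rewrite ?nnegrE ?mulr_ge0 ?powR_ge0 ?(ltW p0)//.
  by rewrite (le_trans _ (ler_norm _))//; lra.
have xy0 : 0 < `|x - y| by rewrite normr_gt0; lra.
have den : 3 `^ (- (s * p + 2)) * N `^ (- (s * p + 2)) <=
    (`|x - y| `^ (s * p + 2))^-1.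
  rewrite -powRM ?(ltW N0)// -powRN le_powR_neg ?oppr_le0//.
  by rewrite ger0_norm; lra.
have -> : (l - s) * p - 2 = l * p + - (s * p + 2) by lra.
rewrite powRD; last by rewrite (gt_eqF N0) implybT.
rewrite mulrACA; apply: ler_pM => //;
  by rewrite mulr_ge0 ?powR_ge0.
Qed.

Lemma not_Wtilde_ge1_power_tail {R : realType} (s p l : R) :
  0 < s -> 0 < p -> s < l -> ~ Wtilde_ge1 (s + 1 / p) p (power_tail l).
Proof.
move=> s0 p0 sl [_]; set I := (X in (X < _)%E).
have l0 : 0 < l by exact: lt_trans sl.
pose b := (l - s) * p; have b0 : 0 < b by rewrite mulr_gt0 ?subr_gt0.
pose c := 2^-1 `^ p * 3 `^ (- (s * p + 2)) : R.
have c0 : 0 < c by rewrite mulr_gt0 ?powR_gt0.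
have g0 (x y : R) : 0 <= gagliardo (s + 1 / p) p (power_tail l) x y.
  by rewrite divr_ge0 ?powR_ge0.
have large (N : R) : 1 <= N -> 2 <= N `^ l -> ((c * N `^ b)%:E <= I)%E.
  move=> N1 Nl; have N0 : 0 < N by exact: lt_le_trans N1.
  (* The pointwise bound has exponent b - 2; the area of the square restores N^2. *)
  have -> : c * N `^ b = c * N `^ (b - 2) * N ^+ 2.
    rewrite -mulrA -(powR_mulrn 2 (ltW N0)) -powRD ?subrK//.
    by rewrite (gt_eqF N0) implybT.
  apply: integral_square_ge => //; first exact: ltW.
    by rewrite mulr_ge0 ?powR_ge0 ?ltW.
  move=> x y xN yN; split; last exact: gagliardo_far_ge.
  move: xN yN => /andP[Nx _] /andP[_ y0] /=.
  by rewrite (le_trans _ (ler_norm _))//; lra.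
have I0 : (0 <= I)%E.
  by apply: integral_ge0 => x _; apply: integral_ge0 => y _; rewrite lee_fin.
have le_powR (u r z : R) : 1 <= z -> 0 <= u -> 0 < r ->
    u `^ r^-1 <= z -> u <= z `^ r.
  move=> z1 u0 r0 uz.
  have -> : u = (u `^ r^-1) `^ r by rewrite -powRrM mulVf ?gt_eqF// powRr1.
  by apply: ge0_ler_powR; rewrite ?nnegrE ?powR_ge0 ?(ltW r0)//; lra.
move=> Ioo; have /fineK IE : I \is a fin_num by rewrite ge0_fin_numE.
have fI0 : 0 <= fine I by exact: fine_ge0.
(* Chosen so that cK = I + 1: then N^b >= K contradicts c N^b <= I. *)
pose K := (fine I + 1) / c.
have K0 : 0 <= K by rewrite divr_ge0 ?addr_ge0 ?ler01 ?(ltW c0).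
(* Each summand secures one requirement: N >= 1, N^l >= 2 and N^b >= K. *)
pose N := 1 + 2 `^ l^-1 + K `^ b^-1.
have N1 : 1 <= N by rewrite /N -addrA lerDl addr_ge0 ?powR_ge0.
have : ((c * N `^ b)%:E <= I)%E.
  apply: large => //; apply: le_powR => //.
  by rewrite /N; have := powR_ge0 K b^-1; lra.
have : K <= N `^ b.
  by apply: le_powR => //; rewrite /N; have := powR_ge0 2 l^-1; lra.
rewrite -IE lee_fin /K ler_pdivrMr// mulrC => h1 h2.
by have := le_trans h1 h2; rewrite gerDl ler10.
Qed.

Theorem mainTheorem4 (R : realType) (s p lambda : R)
  (hs : 0 < s < 1) (hp : 2 < p) (hlambda : 0 < lambda < 1)
  (hps : 1 / p < s) (hsl : s < lambda) (hlp : lambda < 1 - 1 / p) :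
  (Wtilde_le1 (s - 1 / p) p `\` Wtilde_ge1 (s + 1 / p) p) (power_tail lambda).
Proof.
have p0 : 0 < p by exact: lt_trans hp.
have /andP[s0 _] := hs; have /andP[l0 l1] := hlambda.
split; last exact: not_Wtilde_ge1_power_tail.
apply: Wtilde_le1_power_tail; rewrite ?hs ?(ltW l0) ?(ltW l1)//.
(* The integrability condition 1 < (1 - lambda) p is lambda < 1 - 1/p rearranged. *)
by rewrite -ltr_pdivrMr//; lra.
Qed.
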